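(* Let $k\ge 1$ and let $\mathcal{L}=\{\mathcal{M}_1,\dots,\mathcal{M}_k\}$ be a system of $k$ loopless matroids on the same finite non-empty ground set $V$, and let $\bigcap\mathcal{L}=\bigcap_{i=1}^k\mathcal{M}_i$. Then $$R(\mathcal{L}):P\big(\bigcap\mathcal{L}\big)=\max_{w\in\mathbb{R}^V_{\ge 0},\,w\ne 0}\frac{\bar{\tau}^*_w(\mathcal{L})}{\bar{\nu}_w(\mathcal{L})}.$$
   Context: A complex on $V$ is a non-empty family of subsets of $V$ closed under taking subsets; a matroid is identified with the complex of its independent sets; loopless means every singleton is independent. For $f\in\mathbb{R}^V$ and $S\subseteq V$ write $f[S]=\sum_{v\in S}f(v)$. For a complex $\mathcal{C}$ on $V$, $P(\mathcal{C})\subseteq\mathbb{R}^V_{\ge 0}$ is the convex hull of the characteristic vectors $\mathbf{1}_S$, $S\in\mathcal{C}$. Let $R(\mathcal{L})=\bigcap_{i=1}^kP(\mathcal{M}_i)$. A polytope $Z\subseteq\mathbb{R}^V_{\ge 0}$ is closed down if $z\in Z$ and $0\le y\le z$ imply $y\in Z$. For closed-down polytopes $A,B\subseteq\mathbb{R}^V_{\ge 0}$, $B:A=\min\{t\in\mathbb{R}_{\ge 0}: tA\supseteq B\}$ ($\min\emptyset=\infty$), where $tA=\{ta:a\in A\}$. For $w\in\mathbb{R}^V_{\ge 0}$, $\bar{\nu}_w(\mathcal{L})=\max\{w[S]:S\in\bigcap\mathcal{L}\}$. For a matroid $\mathcal{M}$ on $V$, $\mathrm{span}_{\mathcal{M}}(A)$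 denotes the closure of $A\subseteq V$ in $\mathcal{M}$, and for $f:V\to\mathbb{R}$ the $\mathcal{M}$-span of $f$ is $f^{\mathcal{M}}(v)=\max_{T\subseteq V:\,v\in\mathrm{span}_{\mathcal{M}}(T)}\min_{u\in T}f(u)$. A matroidal fractional $w$-cooperative cover is a $k$-tuple $(f_1,\dots,f_k)$ of functions in $\mathbb{R}^V_{\ge 0}$ with $\sum_{i=1}^kf_i^{\mathcal{M}_i}(v)\ge w(v)$ for every $v\in V$, and $\bar{\tau}^*_w(\mathcal{L})$ is the minimum of $\sum_{i=1}^kf_i[V]$ over all of them. *)

(* Defs.v *)
From HB Require Import structures.
From mathcomp Require Import all_boot all_order all_algebra.
From mathcomp Require Import all_classical all_reals.
Set Implicit Arguments.
Unset Strict Implicit.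
Unset Printing Implicit Defensive.
Import Order.TTheory GRing.Theory Num.Theory.
Local Open Scope classical_set_scope.
Local Open Scope ring_scope.

Definition is_minimum d (T : porderType d) (X : set T) (m : T) : Prop :=
  X m /\ lbound X m.

Definition is_maximum d (T : porderType d) (X : set T) (m : T) : Prop :=
  X m /\ ubound X m.

Section Matroids.
Variable V : finType.
Implicit Types (C M : {set {set V}}) (A S T : {set V}).

Definition is_complex C : Prop :=
  C != finset.set0 /\ (forall S T, S \subset T -> T \in C -> S \in C).

Definition is_matroid M : Prop :=
  is_complex M /\
  (forall S T, S \in M -> T \in M -> (#|S| < #|T|)%N ->
     exists2 x, x \in T :\: S & (x |: S)%SET \in M).

Definition loopless M : Prop := forall v : V, [set v]%SET \in M.

Definition matroid_rank M A : nat :=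
  \max_(S : {set V} | (S \in M) && (S \subset A)) #|S|.

Definition matroid_span M A : {set V} :=
  [set v | matroid_rank M (v |: A)%SET == matroid_rank M A]%SET.

Definition matroid_inter k (M : 'I_k -> {set {set V}}) : {set {set V}} :=
  (\bigcap_(i < k) M i)%SET.

Variable R : realType.
Implicit Types (f w x : {ffun V -> R}).

Definition nonneg f : Prop := forall v, 0 <= f v.

Definition wt f S : R := \sum_(v in S) f v.

Definition char_vec S : {ffun V -> R} := [ffun v => (v \in S)%:R].

Definition complex_polytope C : set {ffun V -> R} :=
  [set x | exists lam : {set V} -> R,
     [/\ forall S, S \in C -> 0 <= lam S,
         \sum_(S in C) lam S = 1 &
         forall v, x v = \sum_(S in C) lam S * char_vec S v]].

Definition inter_polytope k (M : 'I_k -> {set {set V}}) :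
    set {ffun V -> R} :=
  [set x | forall i, complex_polytope (M i) x].

Definition dilate (t : R) (A : set {ffun V -> R}) : set {ffun V -> R} :=
  [set [ffun v => t * a v] | a in A].

(* [is_colon B A t] reads  B : A = t,  where [t] is infinite iff no dilate
   of [A] contains [B]. *)
Definition is_colon (B A : set {ffun V -> R}) (t : \bar R) : Prop :=
  let D := [set s : R | 0 <= s /\ B `<=` dilate s A] in
  match t with
  | s%:E => is_minimum D s
  | +oo%E => D = set0
  | -oo%E => False
  end.

(* Total extension of the minimum of [f] on [T]: it is exact for nonempty [T],
   as [top], the maximum of [f], is at least every [f u].  The empty [T] is
   irrelevant to loopless matroids, as its span is then empty. *)
Definition min_on f T (v0 : V) : R :=
  let top := \big[Num.max/f v0]_u f u in
  \big[Num.min/top]_(u in T) f u.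

(* The initial value [f v] is itself attained, by T = {v}. *)
Definition span_fun M f (v : V) : R :=
  \big[Num.max/f v]_(T : {set V} | v \in matroid_span M T) min_on f T v.

Definition is_coop_cover k (M : 'I_k -> {set {set V}}) w
    (f : 'I_k -> {ffun V -> R}) : Prop :=
  (forall i, nonneg (f i)) /\
  (forall v, w v <= \sum_(i < k) span_fun (M i) (f i) v).

Definition is_tau_star k (M : 'I_k -> {set {set V}}) w (t : R) : Prop :=
  is_minimum [set \sum_(i < k) wt (f i) finset.setT | f in is_coop_cover M w] t.

(* For [w] nonnegative the initial value 0 is attained by the empty set. *)
Definition nu k (M : 'I_k -> {set {set V}}) w : R :=
  \big[Num.max/0]_(S in matroid_inter M) wt w S.

End Matroids.

(* Main.v *)
Require Import Defs.
From HB Require Import structures.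
From mathcomp Require Import all_boot all_order all_algebra.
From mathcomp Require Import all_classical all_reals.
From mathcomp Require Import topology normedtype derive.
From mathcomp Require Import ring lra.
Set Implicit Arguments.
Unset Strict Implicit.
Unset Printing Implicit Defensive.
Import Order.TTheory GRing.Theory Num.Theory.
Import numFieldNormedType.Exports.
Local Open Scope classical_set_scope.
Local Open Scope ring_scope.

(** Write [Q] for the intersection of the matroid
    polytopes, [P] for the polytope of the common independent sets, and [w.x]
    for the scalar product [dot w x].

    The first half is a duality: for [w >= 0], the optimal value of a
    cooperative cover is the maximum of [w.x] over [x] in [Q]
    ([tau_star_dual]).  Linear programming duality ([weight_splitting], from
    Farkas' lemma) writes that maximum as the cheapest way to dominate [w] by
    a sum of nonnegative weights [g_i], where [g_i] is charged the largest
    [g_i]-weight of an independent set of the [i]-th matroid.  For a single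
    matroid this charge is also the cost of the cheapest [f] whose span
    dominates [g_i].  A maximum-weight independent set [B] gives such an [f],
    namely [g_i] restricted to [B] ([greedy_cover]); conversely the span of [f]
    weighs at most [f[V]] on any independent set ([span_fun_wt_le]), because
    each superlevel set of the span of [f] lies in the closure of the
    corresponding superlevel set of [f].

    The second half is polarity.  A point [x >= 0] lies in the polytope of a
    complex as soon as it satisfies every valid inequality with nonnegative
    coefficients ([polytope_of_support]), so [Q] is contained in [s P] exactly
    when [w.x <= s * nu w] for all [w >= 0] and [x] in [Q].  Let [t] be the
    maximum of [w.x] over [x] in [Q] and [w] in [W], the set of the
    nonnegative [w] with [nu w <= 1]; it is attained by compactness
    ([polyhedra_dot_max]).  By homogeneity [t] is at once the least such [s]
    and the maximum of [tau w / nu w]. *)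

(** * The lemma of Farkas *)

Definition dot (R : pzSemiRingType) (I : finType) (f x : I -> R) : R :=
  \sum_i f i * x i.

(** Bartl's induction on the number of generators.  If a functional [y] that is
    nonnegative on the first [n] generators separates [b] from their cone,
    then [y] is negative on the last generator, and one can project along that
    generator onto the hyperplane [y = 0] and use the induction hypothesis
    there. *)
Lemma farkas_seq (R : realFieldType) (I : finType) (n : nat)
    (a : nat -> I -> R) (b : I -> R) :
  (forall y : I -> R, (forall j, (j < n)%N -> 0 <= dot y (a j)) ->
     0 <= dot y b) ->
  exists2 lam : nat -> R, forall j, 0 <= lam j &
    forall i, b i = \sum_(j < n) lam j * a j i.
Proof.
elim: n a b => [|n IHn] a b hb.
  exists (fun=> 0) => // i; rewrite big_ord0; apply/eqP.
  pose e (s : R) i' : R := if i' == i then s else 0.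
  have de s : dot (e s) b = s * b i.
    rewrite /dot (bigD1 i) //= big1 ?addr0 /e ?eqxx // => i' /negbTE ->.
    by rewrite mul0r.
  have h s : 0 <= s * b i by rewrite -de; apply: hb.
  by have := h 1; have := h (-1); rewrite eq_le; lra.
(* Either the last generator can be dispensed with, or some y separates b
   from the cone of the others. *)
have [h|] := pselect (forall y : I -> R,
    (forall j, (j < n)%N -> 0 <= dot y (a j)) -> 0 <= dot y b).
  have [lam lam0 E] := IHn _ _ h.
  exists (fun j => if j == n then 0 else lam j) => [j|i]; first by case: eqP.
  rewrite big_ord_recr /= eqxx mul0r addr0 E.
  by apply: eq_bigr => j _; rewrite ltn_eqF.
move=> /existsNP[y /not_implyP[ya /negP]]; rewrite -ltNge => yb.
have ya_n : dot y (a n) < 0.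
  rewrite ltNge; apply/negP => yan; move: yb; rewrite ltNge hb // => j.
  by rewrite ltnS leq_eqVlt => /predU1P[-> //|]; exact: ya.
(* The projection along a n onto the hyperplane y = 0. *)
pose pr (c : I -> R) i := c i - (dot y c / dot y (a n)) * a n i.
have dotB z c s : dot z (fun i => c i - s * a n i) = dot z c - s * dot z (a n).
  rewrite /dot mulr_sumr -sumrB; apply: eq_bigr => i _; ring.
have dot_pr z c : dot z (pr c) =
    dot (fun i => z i - (dot z (a n) / dot y (a n)) * y i) c.
  transitivity (dot z c - dot z (a n) / dot y (a n) * dot y c).
    by rewrite /pr dotB; ring.
  by rewrite /dot mulr_sumr -sumrB; apply: eq_bigr => i _; ring.
have [|lam lam0 E] := IHn (fun j => pr (a j)) (pr b).
  move=> z hz; rewrite dot_pr; apply: hb => j.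
  rewrite ltnS leq_eqVlt => /predU1P[->|jn]; last by rewrite -dot_pr hz.
  by rewrite -dot_pr /pr dotB divff ?mul1r ?subrr // lt_eqF.
(* The coefficient of a n that undoes the projection; it is nonnegative since
   y is negative on b and on a n, and nonnegative on the other generators. *)
pose s := dot y b / dot y (a n) - \sum_(j < n) lam j * (dot y (a j) / dot y (a n)).
have s0 : 0 <= s.
  rewrite subr_ge0; apply: (@le_trans _ _ 0).
    apply: sumr_le0 => j _; apply: mulr_ge0_le0 => //.
    by rewrite mulr_ge0_le0 ?ya // invr_le0 ltW.
  by rewrite mulr_le0 ?invr_le0 // ltW.
exists (fun j => if j == n then s else lam j) => [j|i]; first by case: eqP.
rewrite big_ord_recr /= eqxx.
have -> : \sum_(j < n) (if (j : nat) == n then s else lam j) * a j i =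
          \sum_(j < n) lam j * a j i.
  by apply: eq_bigr => j _; rewrite ltn_eqF.
have -> : \sum_(j < n) lam j * a j i =
    \sum_(j < n) lam j * pr (a j) i +
    (\sum_(j < n) lam j * (dot y (a j) / dot y (a n))) * a n i.
  rewrite mulr_suml -big_split; apply: eq_bigr => j _; rewrite /pr /=; ring.
by rewrite -E /pr /s; ring.
Qed.

Lemma farkas (R : realFieldType) (I J : finType) (a : J -> I -> R) (b : I -> R) :
  (forall y : I -> R, (forall j, 0 <= dot y (a j)) -> 0 <= dot y b) ->
  exists2 lam : J -> R, forall j, 0 <= lam j &
    forall i, b i = \sum_j lam j * a j i.
Proof.
move=> hb.
pose a' n : I -> R := if insub n is Some j then a (@enum_val J predT j) else fun=> 0.
have a'E (j : 'I_#|J|) : a' j = a (enum_val j) by rewrite /a' valK.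
have [|lam lam0 E] := @farkas_seq R I #|J| a' b.
  move=> y hy; apply: hb => j; have := hy (enum_rank j) (ltn_ord _).
  by rewrite a'E enum_rankK.
exists (fun j => lam (enum_rank j)) => // i; rewrite E.
rewrite (reindex (@enum_rank J)) /=.
  by apply: eq_bigr => j _; rewrite a'E enum_rankK.
by exists enum_val => j _; rewrite ?enum_rankK ?enum_valK.
Qed.

(** Slack variables turn the system of inequalities into the cone membership
    of [farkas]. *)
Lemma farkas_ineq (R : realFieldType) (I J : finType) (A : I -> J -> R)
    (b : I -> R) :
  (forall u : I -> R, (forall i, 0 <= u i) ->
     (forall j, 0 <= \sum_i u i * A i j) -> 0 <= dot u b) ->
  exists2 z : J -> R, forall j, 0 <= z j & forall i, dot (A i) z <= b i.
Proof.
move=> hb.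
pose a (c : J + I) i : R :=
  match c with inl j => A i j | inr i' => (i == i')%:R end.
have [|z z0 E] := @farkas R I (J + I)%type a b.
  move=> u hu; apply: hb => [i|j]; last exact: hu (inl j).
  have := hu (inr i); rewrite /dot (bigD1 i) //= eqxx mulr1 big1 ?addr0 // => i'.
  by move=> /negbTE ->; rewrite mulr0.
exists (fun j => z (inl j)) => // i; rewrite E big_sumType /= /dot.
under eq_bigr do rewrite mulrC.
by rewrite lerDl sumr_ge0 // => i' _; rewrite mulr_ge0.
Qed.

(** * Maximising the scalar product over two compact polyhedra *)

(** The cuts form an arbitrary set of pairs (normal, bound), so that infinitely
    many valid inequalities may be imposed without choosing finitely many of
    them. *)
Definition polyhedron (R : realType) (V : finType) (B : V -> R)
    (D : set ((V -> R) * R)) : set {ffun V -> R} :=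
  [set x | (forall v, 0 <= x v <= B v) /\ forall h, D h -> dot h.1 x <= h.2].

Lemma continuous_dot (R : realType) (T : topologicalType) (V : finType)
    (p q : V -> T -> R) :
  (forall v, continuous (p v)) -> (forall v, continuous (q v)) ->
  continuous (fun z => dot (p^~ z) (q^~ z) : R).
Proof.
move=> cp cq z.
have sumP := @cvg_big R V +%R 0 predT _ _ (nbhs z) (index_enum V)
  (fun v z => p v z * q v z) (fun v => p v z * q v z) _ _.
apply: sumP => [|v _].
  by move=> z0; apply: cvgD; [exact: cvg_fst|exact: cvg_snd].
by apply: cvgM; [exact: cp|exact: cq].
Qed.

(** The product of the two polyhedra, seen as a set of functions on [V + V], is
    a closed subset of a product of segments, hence compact, and the scalar
    product is continuous on it. *)
Lemma polyhedra_dot_max (R : realType) (V : finType) (B B' : V -> R)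
    (D D' : set ((V -> R) * R)) (w x : {ffun V -> R}) :
  polyhedron B D w -> polyhedron B' D' x ->
  exists w0 x0, [/\ polyhedron B D w0, polyhedron B' D' x0 &
    forall w1 x1, polyhedron B D w1 -> polyhedron B' D' x1 ->
      dot w1 x1 <= dot w0 x0].
Proof.
move=> wP xP.
pose T := {ptws (V + V)%type -> R}.
pose box (i : V + V) : R := match i with inl v => B v | inr v => B' v end.
pose l (z : T) v : R := z (inl v); pose r (z : T) v : R := z (inr v).
pose K := [set z : T | polyhedron B D [ffun v => l z v] /\
                       polyhedron B' D' [ffun v => r z v]].
have cproj i : continuous (fun z : T => z i : R).
  exact: (@proj_continuous _ (fun=> R) i).
have fE (f g : V -> R) : dot f [ffun v => g v] = dot f g.
  by apply: eq_bigr => v _; rewrite ffunE.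
have cK : compact K.
  have -> : K = [set z : T | forall i, `[0%R, box i]%classic (z i)] `&`
      (\bigcap_(h in D)
         ((fun z : T => dot h.1 (l z) : R) @^-1` [set s | s <= h.2]) `&`
       \bigcap_(h in D')
         ((fun z : T => dot h.1 (r z) : R) @^-1` [set s | s <= h.2])).
    apply/seteqP; split=> z /=.
      move=> -[[h1 h2] [h3 h4]]; split; last first.
        by split=> h Dh /=; rewrite -fE; [exact: h2|exact: h4].
      by move=> [] v; rewrite in_itv /=; [have := h1 v|have := h3 v]; rewrite ffunE.
    move=> [h1 [h2 h3]]; split; split=> [v|h Dh].
    - by have := h1 (inl v); rewrite in_itv ffunE.
    - by rewrite fE; exact: h2.
    - by have := h1 (inr v); rewrite in_itv ffunE.
    - by rewrite fE; exact: h3.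
  apply: compact_closedI.
    apply: (@tychonoff _ (fun=> R) (fun i => `[0%R, box i]%classic)) => i.
    exact: segment_compact.
  apply: closedI; apply: closed_bigI => h _.
  - apply: preimage_closed; last exact: closed_le.
    move=> ? _; apply: (@continuous_dot R T V (fun v _ => h.1 v) (fun v z => l z v)).
      by move=> v; exact: cst_continuous.
    by move=> v; exact: cproj.
  - apply: preimage_closed; last exact: closed_le.
    move=> ? _; apply: (@continuous_dot R T V (fun v _ => h.1 v) (fun v z => r z v)).
      by move=> v; exact: cst_continuous.
    by move=> v; exact: cproj.
pose pr (w x : V -> R) : T := fun i => match i with inl v => w v | inr v => x v end.
have ffK (f : {ffun V -> R}) : [ffun v => f v] = f.
  by apply/ffunP => v; rewrite ffunE.
have K0 : K !=set0 by exists (pr w x); rewrite /K /= /l /r /= !ffK.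
have cF : {within K, continuous (fun z : T => dot (l z) (r z) : R)}.
  apply: continuous_subspaceT.
  by apply: (@continuous_dot R T V (fun v z => l z v) (fun v z => r z v)) => v;
    exact: cproj.
have [z] := compact_EVT_max K0 cK cF.
rewrite inE => -[z1 z2] zmax; exists [ffun v => l z v], [ffun v => r z v].
split=> // w1 x1 w1P x1P.
have := zmax (pr w1 x1); rewrite inE /K /= {1}/l {1}/r /= !ffK.
move=> /(_ (conj w1P x1P)).
by rewrite fE /dot; under [X in _ -> _ <= X]eq_bigr do rewrite ffunE.
Qed.

(** * Independence and span in a matroid *)

Section MatroidSpan.
Variables (V : finType) (M : {set {set V}}).
Hypothesis hM : is_matroid M.
Implicit Types (A B I J K L S T : {set V}).

Lemma matroid_sub S T : S \subset T -> T \in M -> S \in M.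
Proof. by case: hM => -[_ h] _; exact: h. Qed.

Lemma matroid0 : finset.set0 \in M.
Proof.
by case: hM => -[/finset.set0Pn[S SM] _] _; exact: matroid_sub (finset.sub0set S) SM.
Qed.

Lemma matroid_extend I J : I \in M -> J \in M -> (#|I| <= #|J|)%N ->
  exists K, [/\ K \in M, I \subset K, K \subset I :|: J & #|K| = #|J|].
Proof.
move=> + JM; move E: (#|J| - #|I|)%N => n.
elim: n I E => [|n IHn] I E IM leIJ.
  exists I; split=> //; first exact: finset.subsetUl.
  by apply/eqP; rewrite eqn_leq leIJ -subn_eq0 E.
have ltIJ : (#|I| < #|J|)%N by rewrite -subn_gt0 E.
have [x xJI xIM] := (proj2 hM) I J IM JM ltIJ.
move: xJI; rewrite inE => /andP[xI xJ].
have cx : #|x |: I| = #|I|.+1 by rewrite cardsU1 xI.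
have [|||K [KM sK KU cK]] := IHn (x |: I); rewrite ?cx //.
  by rewrite subnS E.
exists K; split=> //; first exact: fintype.subset_trans (finset.subsetUr _ _) sK.
apply: fintype.subset_trans KU _; apply/fintype.subsetP => z.
by rewrite !inE => /orP[/predU1P[->|->]|->]; rewrite ?xJ ?orbT.
Qed.

Lemma rank_ge S A : S \in M -> S \subset A -> (#|S| <= matroid_rank M A)%N.
Proof.
move=> SM SA; rewrite /matroid_rank.
by apply: (@leq_bigmax_cond _ _ (fun S : {set V} => #|S|) S); rewrite SM.
Qed.

Lemma rank_basis A : exists B, [/\ B \in M, B \subset A & #|B| = matroid_rank M A].
Proof.
have : (0 < #|[pred S | (S \in M) && (S \subset A)]|)%N.
  by apply/card_gt0P; exists finset.set0; rewrite inE matroid0 finset.sub0set.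
move=> /(eq_bigmax_cond (fun S : {set V} => #|S|))[B]; rewrite inE => /andP[BM BA] E.
by exists B; split=> //; rewrite -E.
Qed.

Lemma span_mem A v : v \in A -> v \in matroid_span M A.
Proof. by move=> vA; rewrite inE (finset.setUidPr _) // finset.sub1set. Qed.

Lemma span_insert_dep T B v : v \in matroid_span M T -> B \in M ->
  B \subset T -> #|B| = matroid_rank M T -> v \notin B -> v |: B \notin M.
Proof.
rewrite inE => /eqP E BM BT cB vB; apply/negP => vBM.
have := rank_ge vBM (finset.setUS [set v]%SET BT).
by rewrite E -cB cardsU1 vB ltnn.
Qed.

(** Grow a basis [B] of [T] inside a basis [D] of [v |: L] to an independent
    set as large as [D]: it avoids [v], which depends on [B], so it lies in
    [L] and the rank of [L] is as large as that of [v |: L]. *)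
Lemma span_mono T L v : T \subset L -> v \in matroid_span M T ->
  v \in matroid_span M L.
Proof.
move=> TL vT; have [vL|vL] := boolP (v \in L); first exact: span_mem.
have [B [BM BT cB]] := rank_basis T.
have [D [DM DL cD]] := rank_basis (v |: L).
have vB : v \notin B.
  by apply: contra vL => /(fintype.subsetP BT)/(fintype.subsetP TL).
rewrite inE eqn_leq; apply/andP; split; last first.
  have [D' [D'M D'L <-]] := rank_basis L.
  by apply: rank_ge D'M _; apply: fintype.subset_trans D'L (finset.subsetUr _ _).
have leBD : (#|B| <= #|D|)%N.
  rewrite cD; apply: rank_ge BM _.
  apply: fintype.subset_trans (finset.subsetUr _ _).
  exact: fintype.subset_trans BT TL.
have [K [KM BK KU cK]] := matroid_extend BM DM leBD.
rewrite -cD -cK; apply: rank_ge => //.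
apply/fintype.subsetP => z zK.
have : z \in v |: L.
  have /finset.setUP[zB|] := fintype.subsetP KU z zK;
    last exact: (fintype.subsetP DL).
  by rewrite inE (fintype.subsetP TL) ?orbT // (fintype.subsetP BT).
rewrite inE => /orP[|//]; rewrite inE => /eqP zv; exfalso.
have := span_insert_dep vT BM BT cB vB; rewrite (matroid_sub _ KM) //.
by rewrite finset.subUset finset.sub1set -zv zK.
Qed.

(** Otherwise an element of [J] could be exchanged into a basis of [L],
    although it depends on [L]. *)
Lemma card_indep_span J L :
  J \in M -> J \subset matroid_span M L -> (#|J| <= #|L|)%N.
Proof.
move=> JM JL; have [B [BM BL cB]] := rank_basis L.
apply: (@leq_trans #|B|); last exact: subset_leq_card.
rewrite leqNgt; apply/negP => ltBJ.
have [x xJB xBM] := (proj2 hM) B J BM JM ltBJ.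
move: xJB; rewrite inE => /andP[xB xJ].
by have := span_insert_dep (fintype.subsetP JL x xJ) BM BL cB xB; rewrite xBM.
Qed.

Lemma indep_insert T v : T \in M -> v \notin matroid_span M T -> v |: T \in M.
Proof.
move=> TM vT; have [D [DM DT cD]] := rank_basis (v |: T).
have vnT : v \notin T by apply: contra vT; exact: span_mem.
suff -> : v |: T = D by [].
apply/esym/eqP; rewrite eqEcard DT cD cardsU1 vnT add1n /=.
have rT : #|T| = matroid_rank M T.
  apply/eqP; rewrite eqn_leq rank_ge //=.
  by have [B [_ BT <-]] := rank_basis T; exact: subset_leq_card.
rewrite rT ltn_neqAle; apply/andP; split; first by move: vT; rewrite inE eq_sym.
by rewrite -rT; apply: rank_ge TM _; exact: finset.subsetUr.
Qed.

Hypothesis hl : loopless M.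

Lemma span_set0 v : v \notin matroid_span M finset.set0.
Proof.
apply/negP => v0; have := span_insert_dep v0 matroid0 (finset.sub0set _).
rewrite cards0 inE /= finset.setU0 hl => /(_ _ isT).
case: (rank_basis finset.set0) => B [_].
by rewrite finset.subset0 => /eqP-> <-; rewrite cards0 => /(_ erefl).
Qed.

Variable R : realType.
Implicit Types (f g x w : {ffun V -> R}).

Lemma wt_setU1 f A v : v \notin A -> wt f (v |: A) = f v + wt f A.
Proof. by move=> vA; rewrite /wt big_setU1. Qed.

Lemma wt_setD1 f A v : v \in A -> wt f A = f v + wt f (A :\ v).
Proof. by move=> vA; rewrite /wt (big_setD1 v). Qed.

End MatroidSpan.

(** * Spans of functions and their weights *)

(** A discrete layer-cake principle.  Match a largest value of [p] with any
    value of [f] at least as large: deleting both entries preserves the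
    hypothesis, since no threshold above the deleted value of [p] counts
    anything on the left. *)
Lemma sum_le_of_level_card (R : realDomainType) (V : finType) (p f : V -> R)
    (A B : {set V}) :
  (forall u, u \in B -> 0 <= f u) ->
  (forall c, 0 < c -> (#|[set v in A | (c <= p v)%R]%SET|
                       <= #|[set u in B | (c <= f u)%R]%SET|)%N) ->
  \sum_(v in A) p v <= \sum_(u in B) f u.
Proof.
move E: #|A| => n; elim: n A B E => [|n IHn] A B E f0 h.
  by rewrite (cards0_eq E) big_set0 sumr_ge0.
have /card_gt0P[a0 a0A] : (0 < #|A|)%N by rewrite E.
have [a aA amax] : exists2 a, a \in A & forall v, v \in A -> p v <= p a.
  by have [a aA amax] := arg_maxP p a0A; exists a.
have [pa|pa] := lerP (p a) 0.
  apply: (@le_trans _ _ 0); last exact: sumr_ge0.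
  by apply: sumr_le0 => v vA; apply: le_trans pa; exact: amax.
have : (0 < #|[set u in B | (p a <= f u)%R]%SET|)%N.
  by apply: leq_trans (h _ pa); apply/card_gt0P; exists a; rewrite inE lexx andbT.
move=> /card_gt0P[u]; rewrite inE => /andP[uB pau].
rewrite (big_setD1 a) //= (big_setD1 u uB) /=; apply: lerD => //.
apply: IHn => [|v|c c0].
- by move: E; rewrite (cardsD1 a) aA => -[].
- by rewrite inE => /andP[_]; exact: f0.
have [ca|ca] := lerP c (p a); last first.
  have -> : [set v in A :\ a | c <= p v]%SET = finset.set0; last by rewrite cards0.
  apply/finset.setP => v; rewrite !inE; apply/negbTE.
  rewrite -andbA; apply/and3P => -[_ vA].
  by rewrite leNgt (le_lt_trans (amax v vA) ca).
have rm (C : {set V}) (q : V -> R) z : z \in C -> c <= q z ->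
    #|[set v in C | c <= q v]%SET| = #|[set v in C :\ z | c <= q v]%SET|.+1.
  move=> zC cz; rewrite (cardsD1 z) inE zC cz; congr (_.+1).
  by apply: eq_card => v; rewrite !inE andbA.
by have := h c c0; rewrite (rm A p a) // (rm B f u) // (le_trans ca pau).
Qed.

Lemma span_fun_ge (R : realType) (V : finType) (M : {set {set V}})
    (f : {ffun V -> R}) v (T : {set V}) (c : R) :
  v \in matroid_span M T -> T != finset.set0 -> (forall u, u \in T -> c <= f u) ->
  c <= span_fun M f v.
Proof.
move=> vT /finset.set0Pn[u0 u0T] h; apply: (@le_trans _ _ (min_on f T v)).
  apply/bigmin_geP; split=> [|u /h //].
  by apply: le_trans (h _ u0T) _; exact: le_bigmax.
exact: le_bigmax_cond (fun T : {set V} => min_on f T v) vT.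
Qed.

Lemma span_fun_level (R : realType) (V : finType) (M : {set {set V}})
    (f : {ffun V -> R}) v (c : R) : is_matroid M ->
  c <= span_fun M f v -> v \in matroid_span M [set u | (c <= f u)%R]%SET.
Proof.
move=> hM; rewrite /span_fun => /bigmax_geP[cv|[T vT]].
  by apply: span_mem; rewrite inE.
rewrite /min_on => /bigmin_geP[_ cT].
by apply: span_mono vT => //; apply/fintype.subsetP => u uT; rewrite inE cT.
Qed.

(** Apply the layer-cake principle: the part of [J] where the span of [f] is at
    least [c] is independent and is spanned by the elements where [f] is at
    least [c]. *)
Lemma span_fun_wt_le (R : realType) (V : finType) (M : {set {set V}})
    (f : {ffun V -> R}) (J : {set V}) : is_matroid M -> nonneg f -> J \in M ->
  \sum_(v in J) span_fun M f v <= wt f finset.setT.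
Proof.
move=> hM f0 JM; apply: sum_le_of_level_card => // c c0.
have -> : [set u in finset.setT | c <= f u]%SET = [set u | c <= f u]%SET.
  by apply/finset.setP => u; rewrite !inE.
apply: (card_indep_span hM).
  apply: (matroid_sub hM _ JM).
  by apply/fintype.subsetP => v; rewrite inE => /andP[].
by apply/fintype.subsetP => v; rewrite inE => /andP[_]; exact: span_fun_level.
Qed.

(** Take [B] of maximum [g]-weight and [f = g] on [B], [f = 0] elsewhere.  An
    element [v] with [g v > 0] is spanned by the elements of [B] of weight at
    least [g v]: if not, adding [v] to these elements and exchanging, in the
    worst case, one lighter element of [B] would produce a heavier independent
    set. *)
Lemma greedy_cover (R : realType) (V : finType) (M : {set {set V}})
    (g : {ffun V -> R}) : is_matroid M -> loopless M -> nonneg g ->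
  exists2 B, B \in M & exists f : {ffun V -> R},
    [/\ nonneg f, wt f finset.setT = wt g B &
        forall v, g v <= span_fun M f v].
Proof.
move=> hM hl g0.
have [B BM Bmax] : exists2 B, B \in M & forall S, S \in M -> wt g S <= wt g B.
  by have [B BM Bmax] := arg_maxP (wt g) (matroid0 hM); exists B.
exists B => //; exists [ffun v => if v \in B then g v else 0]; split=> [v||v].
- by rewrite ffunE; case: ifP.
- rewrite /wt [RHS]big_mkcond; apply: eq_big => [v|v _]; first by rewrite inE.
  by rewrite ffunE.
(* For g v = 0 nothing has to be spanned. *)
have [gv|gv] := lerP (g v) 0.
  apply: le_trans gv _.
  apply: (@le_trans _ _ ([ffun v => if v \in B then g v else 0] v)).
    by rewrite ffunE; case: ifP.
  exact: bigmax_ge_id.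
pose T := [set u in B | (g v <= g u)%R]%SET.
have TB : T \subset B by apply/fintype.subsetP => u; rewrite inE => /andP[].
have TM := matroid_sub hM TB BM.
have vT : v \in matroid_span M T.
  have [vB|vB] := boolP (v \in B); first by apply: span_mem; rewrite inE vB lexx.
  have vnT : v \notin T by apply: contra vB; exact/fintype.subsetP.
  apply/negPn/negP => nvT.
  have vTM : v |: T \in M by exact: indep_insert.
  have [leTB|ltBT] := leqP #|v |: T| #|B|.
    have [K [KM sK KU cK]] := matroid_extend hM vTM BM leTB.
    have vK : v \in K by rewrite (fintype.subsetP sK) // !inE eqxx.
    have KB : K :\ v \subset B.
      apply/fintype.subsetP => z; rewrite inE => /andP[zv /(fintype.subsetP KU)].
      move: zv; rewrite !inE => /negbTE-> /=.
      by case: (z \in B) => //; rewrite orbF => /andP[].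
    have : (0 < #|B :\: (K :\ v)|)%N.
      move: cK; rewrite cardsD (finset.setIidPr KB) (cardsD1 v K) vK => <-.
      by rewrite addnK.
    move=> /card_gt0P[u]; rewrite finset.in_setD => /andP[uK uB].
    have uv : u != v by apply: contraNneq vB => <-.
    have gu : g u < g v.
      rewrite ltNge; apply: contra uK => gvu; rewrite !inE uv.
      by rewrite (fintype.subsetP sK) // !inE uB gvu orbT.
    have EK : K :\ v = B :\ u.
      apply/eqP; rewrite eqEcard; apply/andP; split.
        by apply/subsetD1P.
      by move: cK; rewrite (cardsD1 v K) vK (cardsD1 u B) uB !add1n => -[->].
    have := Bmax K KM; rewrite (wt_setD1 g vK) (wt_setD1 g uB) EK lerD2r.
    by rewrite leNgt gu.
  have EB : T = B.
    by apply/eqP; rewrite eqEcard TB; move: ltBT; rewrite cardsU1 vnT add1n ltnS.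
  by have := Bmax _ vTM; rewrite wt_setU1 // EB gerDr leNgt gv.
apply: (span_fun_ge vT).
  by apply: contraTneq vT => ->; exact: span_set0.
by move=> u; rewrite inE => /andP[uB gvu]; rewrite ffunE uB.
Qed.

(** * The polytope of a complex and its valid inequalities *)

Section Polytope.
Variables (R : realType) (V : finType).
Implicit Types (C : {set {set V}}) (S : {set V}) (w x : {ffun V -> R}).

Lemma dot_char_vec w S : dot w (char_vec R S) = wt w S.
Proof.
rewrite /dot /wt [RHS]big_mkcond; apply: eq_bigr => v _; rewrite ffunE.
by case: ifP; rewrite ?mulr1 ?mulr0.
Qed.

Lemma dot_polytope (w : V -> R) C x lam :
  (forall v, x v = \sum_(S in C) lam S * char_vec R S v) ->
  dot w x = \sum_(S in C) lam S * \sum_(v in S) w v.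
Proof.
move=> E; rewrite /dot; under eq_bigr do rewrite E mulr_sumr.
rewrite exchange_big; apply: eq_bigr => S _.
rewrite mulr_sumr [RHS]big_mkcond; apply: eq_bigr => v _; rewrite ffunE.
by case: ifP => _; rewrite ?mulr1 ?mulr0 // mulrC.
Qed.

Lemma dot_polytope_le (w : V -> R) C x (c : R) : complex_polytope C x ->
  (forall S, S \in C -> \sum_(v in S) w v <= c) -> dot w x <= c.
Proof.
move=> [lam [lam0 lam1 /dot_polytope ->]] h.
apply: (@le_trans _ _ (\sum_(S in C) lam S * c)).
  by apply: ler_sum => S SC; rewrite ler_wpM2l ?lam0 ?h.
by rewrite -mulr_suml lam1 mul1r.
Qed.

Lemma polytope_nonneg C x : complex_polytope C x -> nonneg x.
Proof.
move=> [lam [lam0 _ E]] v; rewrite E sumr_ge0 // => S SC.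
by rewrite mulr_ge0 ?lam0 // ffunE ler0n.
Qed.

(** Polarity with nonnegative normals.  Farkas' lemma, with one more coordinate
    for the condition that the coefficients sum to 1, separates a point outside
    the polytope by a normal of any sign.  Replacing this normal by its
    positive part keeps the inequality valid, since the complex is closed under
    taking subsets, and can only increase the value at [x >= 0]. *)
Lemma polytope_of_support C x : is_complex C -> nonneg x ->
  (forall w c, nonneg w -> (forall S, S \in C -> wt w S <= c) -> dot w x <= c) ->
  complex_polytope C x.
Proof.
move=> [C0 Csub] x0 h.
(* Vectors indexed by sets outside C are zero, so they do not contribute. *)
pose a S (i : option V) : R :=
  if S \in C then if i is Some v then char_vec R S v else 1 else 0.
pose b (i : option V) : R := if i is Some v then x v else 1.
have dotE (y : option V -> R) (z : option V -> R) :
    dot y z = y None * z None + \sum_v y (Some v) * z (Some v).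
  rewrite /dot (bigD1 None) //=; congr (_ + _).
  rewrite (reindex_omap Some id) /=; last by case.
  by apply: eq_bigl => v; rewrite eqxx.
have [|lam lam0 E] := @farkas R _ _ a b.
  move=> y hy; pose w := [ffun v => Num.max 0 (- y (Some v))].
  have w0 : nonneg w by move=> v; rewrite ffunE le_max lexx.
  have wc S : S \in C -> wt w S <= y None.
    (* w charges S exactly as - y charges S'. *)
    move=> SC; pose S' := [set v in S | y (Some v) < 0]%SET.
    have S'C : S' \in C.
      by apply: Csub SC; apply/fintype.subsetP => v; rewrite inE => /andP[].
    have := hy S'; rewrite dotE /a S'C mulr1 -lerBlDr sub0r; apply: le_trans.
    rewrite -sumrN /wt big_mkcond; apply: ler_sum => v _; rewrite !ffunE inE.
    case: (v \in S); last by rewrite mulr0 oppr0.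
    by case: ltrP => [?|?]; [rewrite mulr1|rewrite mulr0 oppr0];
      rewrite ge_max ?lexx ?oppr_ge0 ?oppr_le0 ?andbT // ltW.
  have := h w (y None) w0 wc.
  rewrite dotE /= mulr1 -subr_ge0 => /le_trans -> //.
  rewrite lerD2l -sumrN; apply: ler_sum => v _; rewrite -mulNr.
  by rewrite ler_wpM2r // ffunE lerNl le_max lexx orbT.
exists lam; split=> [S _ //||v].
  have := E None; rewrite /b => ->; rewrite big_mkcond; apply: eq_bigr => S _.
  by rewrite /a; case: ifP; rewrite ?mulr1 ?mulr0.
have := E (Some v); rewrite /b => ->; rewrite [RHS]big_mkcond.
by apply: eq_bigr => S _; rewrite /a; case: ifP; rewrite ?mulr0.
Qed.
End Polytope.

(** * Linear programming duality over an intersection of polytopes *)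

Lemma sum_pair_at (R : nmodType) (I J : finType) (F : I * J -> R) (i : I) :
  (forall p, p.1 != i -> F p = 0) -> \sum_p F p = \sum_j F (i, j).
Proof.
move=> F0; transitivity (\sum_p F (p.1, p.2)); first by apply: eq_bigr => -[].
rewrite -(pair_bigA _ (fun i j => F (i, j))) /= (bigD1 i) //=.
by rewrite [X in _ + X]big1 ?addr0 // => i' i'i; apply: big1 => j _; exact: F0.
Qed.

(** The unknowns are the values [g i v] and the bounds [s i].  A Farkas
    certificate of infeasibility consists of a point [x], of coefficients
    [lam i S] dominating [x] by a combination of the sets of [C i], and of a
    scalar [q] bounding the sums of these coefficients.  Then [x / q] belongs
    to all the polytopes, and [w] would exceed the bound [t] there. *)
Lemma weight_splitting (R : realType) (V : finType) (k : nat)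
    (C : 'I_k -> {set {set V}}) (w : {ffun V -> R}) (t : R) :
  (0 < k)%N -> (forall i, is_complex (C i)) ->
  (forall x, inter_polytope C x -> dot w x <= t) ->
  exists (g : 'I_k -> {ffun V -> R}) (s : 'I_k -> R),
    [/\ forall i, nonneg (g i), forall v, w v <= \sum_i g i v,
        forall i S, S \in C i -> wt (g i) S <= s i & \sum_i s i <= t].
Proof.
move=> k0 hC hx.
pose I := (V + ('I_k * {set V}) + unit)%type; pose J := ('I_k * V + 'I_k)%type.
pose A (c : I) (j : J) : R :=
  match c, j with
  | inl (inl v), inl p => if v == p.2 then -1 else 0
  | inl (inl v), inr i => 0
  | inl (inr p), inl q =>
      if (p.1 == q.1) && (p.2 \in C p.1) && (q.2 \in p.2) then 1 else 0
  | inl (inr p), inr i => if (p.1 == i) && (p.2 \in C p.1) then -1 else 0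
  | inr _, inl _ => 0
  | inr _, inr _ => 1
  end.
pose b (c : I) : R :=
  match c with inl (inl v) => - w v | inl (inr _) => 0 | inr _ => t end.
have [|z z0 zb] := @farkas_ineq R I J A b.
  move=> u u0 uA.
  pose x := [ffun v => u (inl (inl v))]; pose q := u (inr tt).
  pose lam i S := u (inl (inr (i, S))).
  have x0 : nonneg x by move=> v; rewrite ffunE.
  have q0 : 0 <= q by exact: u0.
  have xlam i v : x v <= \sum_(S in C i) lam i S * (v \in S)%:R.
    have := uA (inl (i, v)); rewrite !big_sumType /=.
    rewrite (bigD1 v) //= eqxx big1 ?addr0; last first.
      by move=> v' /negbTE->; rewrite mulr0.
    rewrite (sum_pair_at (i := i)) /=; last by move=> p /negbTE-> /=; rewrite mulr0.
    rewrite [X in _ + _ + X]big1 ?addr0; last by move=> [] _; rewrite mulr0.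
    rewrite mulrN1 addrC subr_ge0 ffunE => /le_trans; apply.
    rewrite [leRHS]big_mkcond; apply: ler_sum => S _; rewrite eqxx /=.
    by case: (S \in C i); case: (v \in S); rewrite /= ?mulr0 ?mulr1.
  have lamq i : \sum_(S in C i) lam i S <= q.
    have := uA (inr i); rewrite !big_sumType /=.
    rewrite big1 ?add0r; last by move=> v _; rewrite mulr0.
    rewrite (sum_pair_at (i := i)) /=; last by move=> p /negbTE-> /=; rewrite mulr0.
    rewrite (bigD1 tt) //= [X in _ + (_ + X)]big1 ?addr0; last by case.
    rewrite mulr1 -lerBlDl sub0r; apply: le_trans.
    rewrite -sumrN big_mkcond; apply: ler_sum => S _; rewrite eqxx /=.
    by case: (S \in C i); rewrite ?mulr0 ?mulrN1 ?opprK ?oppr0.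
  have xq i (w' : {ffun V -> R}) c : nonneg w' ->
      (forall S, S \in C i -> wt w' S <= c) -> dot w' x <= q * c.
    move=> w0 wc.
    have c0 : 0 <= c.
      have [/finset.set0Pn[S SC] _] := hC i.
      by apply: le_trans (wc S SC); apply: sumr_ge0 => v _; exact: w0.
    apply: (@le_trans _ _ (\sum_(S in C i) lam i S * wt w' S)).
      rewrite -(@dot_polytope R V w' (C i)
        [ffun v => \sum_(S in C i) lam i S * char_vec R S v]); last first.
        by move=> v; rewrite ffunE.
      apply: ler_sum => v _; rewrite ler_wpM2l // [leRHS]ffunE.
      by under eq_bigr do rewrite ffunE.
    apply: (@le_trans _ _ (\sum_(S in C i) lam i S * c)).
      by apply: ler_sum => S SC; rewrite ler_wpM2l ?wc // u0.
    by rewrite -mulr_suml ler_wpM2r.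
  have -> : dot u b = q * t - dot w x.
    rewrite /dot !big_sumType /= [X in _ + X + _]big1 ?addr0; last first.
      by move=> p _; rewrite mulr0.
    rewrite (bigD1 tt) //= [X in _ + (_ + X)]big1 ?addr0; last by case.
    rewrite addrC -sumrN; congr (_ + _); apply: eq_bigr => v _.
    by rewrite ffunE; ring.
  rewrite subr_ge0.
  have [qp|] := ltrP 0 q.
    have := hx [ffun v => q^-1 * x v].
    have dE (f : V -> R) : dot f [ffun v => q^-1 * x v] = dot f x / q.
      by rewrite /dot mulr_suml; apply: eq_bigr => v _; rewrite ffunE; ring.
    rewrite dE ler_pdivrMr // mulrC; apply => i; apply: polytope_of_support => //.
      by move=> v; rewrite ffunE mulr_ge0 // invr_ge0.
    by move=> w' c w0 wc; rewrite dE ler_pdivrMr // mulrC; exact: xq w0 wc.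
  (* When q = 0 all coefficients vanish, and with them x; this needs one
     polytope at least. *)
  move=> qle; have qE : q = 0 by apply/eqP; rewrite eq_le qle q0.
  rewrite qE mul0r; apply: sumr_le0 => v _.
  suff -> : x v = 0 by rewrite mulr0.
  apply/eqP; rewrite eq_le x0 andbT.
  apply: le_trans (xlam (Ordinal k0) v) _; rewrite -[leRHS]qE.
  apply: le_trans (lamq (Ordinal k0)); apply: ler_sum => S _.
  by case: (v \in S); rewrite ?mulr1 ?mulr0 // u0.
exists (fun i => [ffun v => z (inl (i, v))]), (fun i => z (inr i)); split.
- by move=> i v; rewrite ffunE.
- move=> v; have := zb (inl (inl v)); rewrite /b lerNr /dot big_sumType /=.
  rewrite [X in _ + X]big1 ?addr0; last by move=> i _; rewrite mul0r.
  move=> /le_trans; apply.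
  have -> : \sum_(p : 'I_k * V) (if v == p.2 then -1 else 0) * z (inl p) =
      \sum_(i < k) \sum_v' (if v == v' then -1 else 0) * z (inl (i, v')).
    by rewrite pair_bigA; apply: eq_bigr => -[].
  rewrite -sumrN; apply: ler_sum => i _; rewrite (bigD1 v) //= eqxx big1.
    by rewrite addr0 mulN1r opprK ffunE.
  by move=> v' /negbTE; rewrite eq_sym => ->; rewrite mul0r.
- move=> i S SC; have := zb (inl (inr (i, S))); rewrite /b /dot big_sumType /=.
  rewrite (sum_pair_at (i := i)) /=; last first.
    by move=> p /negbTE pi; rewrite eq_sym pi mul0r.
  rewrite [X in _ + X](bigD1 i) //= [X in _ + (_ + X)]big1 ?addr0; last first.
    by move=> i' /negbTE i'i; rewrite eq_sym i'i mul0r.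
  rewrite eqxx SC /= mulN1r subr_le0; apply: le_trans.
  rewrite /wt big_mkcond; apply: ler_sum => v _; rewrite ffunE.
  by case: (v \in S); rewrite ?mul1r ?mul0r.
- have := zb (inr tt); rewrite /b /dot big_sumType /= big1 ?add0r; last first.
    by move=> p _; rewrite mul0r.
  by under eq_bigr do rewrite mul1r.
Qed.

(** * Cooperative covers and the intersection of the matroid polytopes *)

Section Duality.
Variables (R : realType) (V : finType) (k : nat) (M : 'I_k -> {set {set V}}).
Hypothesis k_gt0 : (0 < k)%N.
Implicit Types (w x y e : {ffun V -> R}) (S T : {set V}).

Lemma wt_set1 w v : wt w [set v]%SET = w v.
Proof. by rewrite /wt big_set1. Qed.

Lemma wt_le w S T : nonneg w -> S \subset T -> wt w S <= wt w T.
Proof.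
move=> w0 /fintype.subsetP ST; rewrite /wt big_mkcond [leRHS]big_mkcond.
apply: ler_sum => v _; case: ifP => [/ST->//|_].
by case: ifP => // _; exact: w0.
Qed.

Lemma wt_char_set1 v S : wt (char_vec R [set v]%SET) S <= 1.
Proof.
apply: (@le_trans _ _ (wt (char_vec R [set v]%SET) finset.setT)).
  by apply: wt_le (finset.subsetT _) => u; rewrite ffunE ler0n.
rewrite /wt (bigD1 v) //= ffunE !inE eqxx big1 ?addr0 //.
by move=> u /andP[_ /negbTE uv]; rewrite ffunE inE uv.
Qed.

(** Every inequality with nonnegative normal that is valid for one of the
    polytopes; by polarity these describe the intersection. *)
Definition valid_cuts : set ((V -> R) * R) :=
  [set h | exists i (w : {ffun V -> R}),
     [/\ nonneg w, forall S, S \in M i -> wt w S <= h.2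
       & h.1 = w :> (V -> R)]].

Lemma inter_polytopeE : (forall i, is_complex (M i)) ->
  @inter_polytope V R k M = polyhedron (fun=> 1) valid_cuts.
Proof.
move=> hC; apply/seteqP; split=> x /=.
  move=> xQ; split=> [v|h [i [w [w0 hS ->]]]]; last exact: dot_polytope_le (xQ i) hS.
  have xP := xQ (Ordinal k_gt0); rewrite (polytope_nonneg xP) /=.
  rewrite -wt_set1 -dot_char_vec /dot; under eq_bigr do rewrite mulrC.
  apply: (dot_polytope_le xP) => S SC.
  exact: wt_char_set1.
move=> [x01 hx] i; apply: polytope_of_support => // [v|w c w0 wc].
  by have /andP[] := x01 v.
by apply: (hx (w : V -> R, c)); exists i, w.
Qed.

(** [w] is the greatest element of the box of weights [w'] with [0 <= w' <= w],
    so a maximum over this box and the intersection is one for [w]. *)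
Lemma inter_polytope_max w e :
  (forall i, is_complex (M i)) -> inter_polytope M e -> nonneg w ->
  exists2 x, inter_polytope M x & forall y, inter_polytope M y ->
    dot w y <= dot w x.
Proof.
move=> hC; rewrite inter_polytopeE // => eP w0.
have wP : polyhedron w set0 w by split=> [v|//]; rewrite w0 lexx.
have [w1 [x [[w1w _] xP wx_max]]] := polyhedra_dot_max wP eP.
exists x => // y yP; apply: le_trans (wx_max w y wP yP) _.
apply: ler_sum => v _; apply: ler_wpM2r; last by case/andP: (w1w v).
by case: xP => x01 _; case/andP: (x01 v).
Qed.

(** Weak duality pairs a cover with [x]: in each polytope the span of [f i]
    takes on [x] a value at most [f i [V]].  An optimal cover comes from
    splitting [w] and covering each part greedily in its own matroid. *)
Lemma tau_star_dual w x :
  (forall i, is_matroid (M i)) -> (forall i, loopless (M i)) ->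
  inter_polytope M x ->
  (forall y, inter_polytope M y -> dot w y <= dot w x) ->
  is_tau_star M w (dot w x).
Proof.
move=> hM hl xQ xmax.
have lower f : is_coop_cover M w f -> dot w x <= \sum_(i < k) wt (f i) finset.setT.
  move=> [f0 fw].
  apply: (@le_trans _ _ (\sum_(i < k) dot (span_fun (M i) (f i)) x)).
    rewrite /dot exchange_big /=; apply: ler_sum => v _; rewrite -mulr_suml.
    by rewrite ler_wpM2r // (polytope_nonneg (xQ (Ordinal k_gt0))).
  apply: ler_sum => i _; apply: (dot_polytope_le (xQ i)) => S SM.
  exact: span_fun_wt_le.
split; last by move=> _ [f fc <-]; exact: lower.
have [g [s [g0 gw gs sx]]] :=
  weight_splitting k_gt0 (fun i => proj1 (hM i)) xmax.
have /choice[f fP] i : exists f : {ffun V -> R},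
    [/\ nonneg f, wt f finset.setT <= s i & forall v, g i v <= span_fun (M i) f v].
  have [B BM [f [f0 fB fg]]] := greedy_cover (hM i) (hl i) (g0 i).
  by exists f; split=> //; rewrite fB gs.
have fc : is_coop_cover M w f.
  split=> [i|v]; first by have [] := fP i.
  by apply: le_trans (gw v) _; apply: ler_sum => i _; have [_ _] := fP i.
exists f => //; apply/eqP; rewrite eq_le lower // andbT.
by apply: le_trans sx; apply: ler_sum => i _; have [] := fP i.
Qed.

Lemma matroid_interP S : reflect (forall i, S \in M i) (S \in matroid_inter M).
Proof.
by apply: (iffP finset.bigcapP) => [h i|h i _]; exact: h.
Qed.

Lemma matroid_inter_complex : (forall i, is_complex (M i)) ->
  is_complex (matroid_inter M).
Proof.
move=> hC; have sub i S T : S \subset T -> T \in M i -> S \in M i.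
  by have [_] := hC i; exact.
split=> [|S T ST /matroid_interP TM].
  apply/finset.set0Pn; exists finset.set0; apply/matroid_interP => i.
  have [/finset.set0Pn[S SM] _] := hC i; apply: sub SM; exact: finset.sub0set.
by apply/matroid_interP => i; exact: sub ST (TM i).
Qed.

Lemma wt_le_nu w S : S \in matroid_inter M -> wt w S <= nu M w.
Proof. by move=> SM; exact: le_bigmax_cond (wt w) SM. Qed.

Lemma nu_le w c : 0 <= c -> (forall S, S \in matroid_inter M -> wt w S <= c) ->
  nu M w <= c.
Proof. by move=> c0 h; apply/bigmax_leP. Qed.

Lemma nu_gt0 w : (forall i, loopless (M i)) -> nonneg w -> w <> [ffun=> 0] ->
  0 < nu M w.
Proof.
move=> hl w0 wn0; have [v wv] : exists v, w v != 0.
  apply: contrapT => /forallNP h; apply: wn0; apply/ffunP => v; rewrite ffunE.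
  by apply/eqP; have /negP := h v; rewrite negbK.
apply: (@lt_le_trans _ _ (w v)); first by rewrite lt_neqAle eq_sym wv w0.
rewrite -wt_set1; apply: wt_le_nu; apply/matroid_interP => i; exact: hl.
Qed.

End Duality.

(** * The colon as a maximum ratio *)

Theorem theorem10p6 (R : realType) (V : finType) (k : nat)
    (M : 'I_k -> {set {set V}})
    (hk : (1 <= k)%N) (hV : (0 < #|V|)%N)
    (hM : forall i, is_matroid (M i)) (hl : forall i, loopless (M i)) :
  exists tau : {ffun V -> R} -> R,
    (forall w, nonneg w -> is_tau_star M w (tau w)) /\
    exists t : R,
      is_colon (@inter_polytope V R k M)
        (complex_polytope (matroid_inter M)) t%:E /\
      is_maximum
        [set tau w / nu M w | w in [set w | nonneg w /\ w <> [ffun=> 0]]] t.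
Proof.
have hC i : is_complex (M i) by case: (hM i).
have hI := matroid_inter_complex hC.
pose Q := @inter_polytope V R k M.
have QE : Q = polyhedron (fun=> 1) (@valid_cuts R V k M) by exact: inter_polytopeE.
have /card_gt0P[v0 _] := hV.
pose e := char_vec R [set v0]%SET.
have e0 : nonneg e by move=> v; rewrite ffunE ler0n.
have e1 v : 0 <= e v <= 1 by rewrite e0 ffunE lern1 leq_b1.
have eQ : Q e.
  move=> i; apply: polytope_of_support => // w c w0 wc.
  by rewrite dot_char_vec; apply: wc; exact: hl.
have /choice[tau tauP] w : exists t : R, nonneg w ->
    (exists2 x, Q x & t = dot w x) /\ forall x, Q x -> dot w x <= t.
  have [w0|] := pselect (nonneg w); last by exists 0.
  by have [x xQ xmax] := inter_polytope_max hk hC eQ w0;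
    exists (dot w x); split=> //; exists x.
exists tau; split.
  move=> w w0; have [[x xQ E] xmax] := tauP w w0.
  by rewrite E in xmax *; exact: tau_star_dual.
(* W is the polyhedron of the nonnegative weights w with nu w <= 1; as singletons
   are independent, it lies in the unit cube. *)
pose cuts := [set h : (V -> R) * R |
  exists2 S, S \in matroid_inter M & h = (char_vec R S : V -> R, 1)].
pose W := polyhedron (fun=> 1) cuts.
have dotC (f g : V -> R) : dot f g = dot g f.
  by apply: eq_bigr => v _; rewrite mulrC.
have WP w : nonneg w -> nu M w <= 1 -> W w.
  move=> w0 wn; split=> [v|_ [S SM ->]] /=.
    rewrite w0 /= -wt_set1; apply: le_trans wn; apply: wt_le_nu.
    by apply/matroid_interP => i; exact: hl.
  by rewrite dotC dot_char_vec; apply: le_trans wn; exact: wt_le_nu.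
have WnuP w : W w -> nonneg w /\ nu M w <= 1.
  move=> [w01 hw]; split=> [v|]; first by case/andP: (w01 v).
  apply: nu_le => // S SM; rewrite -dot_char_vec dotC.
  by apply: (hw (char_vec R S : V -> R, 1)); exists S.
have eW : W e by apply: WP => //; apply: nu_le => // S _; exact: wt_char_set1.
have eP := eQ; rewrite QE in eP.
have [w [x [wW xP wxmax]]] := polyhedra_dot_max eW eP.
have xQ : Q x by rewrite QE.
pose t := dot w x.
(* The characteristic vector of a single element lies in both polyhedra. *)
have t_ge1 : 1 <= t.
  apply: le_trans (wxmax e e eW eP).
  by rewrite dot_char_vec wt_set1 ffunE inE eqxx.
have t_gt0 : 0 < t by apply: lt_le_trans t_ge1.
(* Homogeneity: w' / nu w' belongs to W. *)
have max_le w' y : nonneg w' -> w' <> [ffun=> 0] -> Q y -> dot w' y <= t * nu M w'.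
  move=> w'0 w'n0 yQ; have nu0 := nu_gt0 hl w'0 w'n0.
  have yP := yQ; rewrite QE in yP.
  pose w'' := [ffun v => (nu M w')^-1 * w' v].
  have dE (f : V -> R) : dot w'' f = dot w' f / nu M w'.
    by rewrite /dot mulr_suml; apply: eq_bigr => v _; rewrite ffunE; ring.
  have w''W : W w''.
    apply: WP => [v|]; first by rewrite ffunE mulr_ge0 // invr_ge0 ltW.
    apply: nu_le => // S SM; rewrite -dot_char_vec dE ler_pdivrMr // mul1r.
    by rewrite dot_char_vec wt_le_nu.
  by have := wxmax w'' y w''W yP; rewrite dE ler_pdivrMr.
have [w0 wn] := WnuP w wW.
have wn0 : w <> [ffun=> 0].
  move=> wE; move: t_gt0; rewrite /t wE /dot big1 ?ltxx // => v _.
  by rewrite ffunE mul0r.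
exists t; split; last first.
  split=> [|_ [w' [w'0 w'n0] <-]]; last first.
    have [[y yQ ->] _] := tauP w' w'0.
    by rewrite ler_pdivrMr ?nu_gt0 // max_le.
  exists w => //; have nu0 := nu_gt0 hl w0 wn0.
  have [[y yQ E] ymax] := tauP w w0.
  apply/eqP; rewrite eq_le ler_pdivrMr // E max_le //= ler_pdivlMr // -E.
  apply: le_trans (ymax x xQ); rewrite -/t.
  by rewrite ger_pMr.
split.
  split=> [|y yQ]; first exact: ltW.
  exists [ffun v => t^-1 * y v]; last first.
    by apply/ffunP => v; rewrite !ffunE mulVKf // gt_eqF.
  have y0 := polytope_nonneg (yQ (Ordinal hk)).
  apply: polytope_of_support => // [v|w' c w'0 w'c].
    by rewrite ffunE mulr_ge0 // invr_ge0 ltW.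
  have c0 : 0 <= c.
    have [/finset.set0Pn[S SM] _] := hI.
    by apply: le_trans (w'c S SM); apply: sumr_ge0 => v _; exact: w'0.
  have -> : dot w' [ffun v => t^-1 * y v] = dot w' y / t.
    by rewrite /dot mulr_suml; apply: eq_bigr => v _; rewrite ffunE; ring.
  rewrite ler_pdivrMr // mulrC.
  have [w'E|w'n0] := pselect (w' = [ffun=> 0]).
    rewrite /dot big1 ?mulr_ge0 // ?ltW // => v _.
    by rewrite w'E ffunE mul0r.
  apply: le_trans (max_le w' y w'0 w'n0 yQ) _.
  by rewrite ler_pM2l //; exact: nu_le.
move=> s [s0 /(_ x xQ) [a aP ax]].
have -> : t = s * dot w a.
  rewrite /t -ax /dot mulr_sumr; apply: eq_bigr => v _; rewrite ffunE; ring.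
rewrite -[leRHS]mulr1 ler_wpM2l //.
apply: le_trans wn; apply: (dot_polytope_le aP) => S SM.
exact: wt_le_nu.
Qed.
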